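(* Let $N$ be a set of $n$ agents and $M$ a set of $m$ indivisible items. For any binary valuation profile $(v_1,\dots,v_n)$, where $v_i:2^M\to\mathbb{R}_{\ge 0}$ is the valuation function of agent $i$, there exists an EFX allocation $(A_1,\dots,A_n)$ of $M$, and it can be computed by a polynomial-time algorithm.
   Context: A valuation function $v_i:2^M\to\mathbb{R}_{\ge 0}$ is binary if $v_i(\emptyset)=0$ and $v_i(S\cup\{g\})-v_i(S)\in\{0,1\}$ for every $S\subseteq M$ and every $g\in M\setminus S$ (valuations are not required to be additive or submodular); a binary valuation profile is one in which every $v_i$ is binary. An allocation is a partition $(A_1,\dots,A_n)$ of $M$ (so all items are allocated; bundles may be empty), where $A_i$ is the bundle allocated to agent $i$. An allocation is EFX (envy-free up to any item) if $v_i(A_i)\ge v_i(A_j\setminus\{g\})$ for all agents $i,j$ and every item $g\in A_j$. *)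

(* Defs.v *)
From mathcomp Require Import all_boot all_order all_algebra.
From mathcomp Require Import reals.

Set Implicit Arguments.
Unset Strict Implicit.
Unset Printing Implicit Defensive.

Import Order.TTheory GRing.Theory Num.Theory.
Local Open Scope ring_scope.

Definition profile (R : realType) (n m : nat) := 'I_n -> {set 'I_m} -> R.

Definition allocation (n m : nat) := 'I_n -> {set 'I_m}.

Definition nonneg_profile (R : realType) n m (v : profile R n m) : Prop :=
  forall i S, 0 <= v i S.

Definition binary (R : realType) m (f : {set 'I_m} -> R) : Prop :=
  f set0 = 0 /\
  forall (S : {set 'I_m}) (g : 'I_m), g \notin S ->
    f (g |: S) - f S = 0 \/ f (g |: S) - f S = 1.

Definition binary_profile (R : realType) n m (v : profile R n m) : Prop :=
  forall i, binary (v i).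

(* Bundles may be empty, so this is not [finset.partition]. *)
Definition is_allocation n m (A : allocation n m) : Prop :=
  \bigcup_i A i = [set: 'I_m] /\
  forall i j, i != j -> [disjoint A i & A j].

Definition EFX (R : realType) n m (v : profile R n m) (A : allocation n m) :
    Prop :=
  forall (i j : 'I_n) (g : 'I_m), g \in A j -> v i (A j :\ g) <= v i (A i).

Definition EFX_allocation (R : realType) n m (v : profile R n m)
    (A : allocation n m) : Prop :=
  is_allocation A /\ EFX v A.

Local Close Scope ring_scope.

(* Programs are structured RAM programs over finitely many unbounded arrays
   of natural numbers, with indirect addressing and with a value oracle.
   The only arithmetic operations are addition and truncated subtraction, so
   after t steps every stored number has O(t + log(n + m)) bits. There is
   therefore no gain from charging one unit per instruction: up to a
   polynomial, running time is that of an oracle Turing machine. *)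

(* [s a k] is the content of cell k of array a; cell 0 of an array serves as
   a scalar variable. *)
Definition state := nat -> nat -> nat.

Definition update (s : state) (a k x : nat) : state :=
  fun b l => if (b == a) && (l == k) then x else s b l.

Inductive expr : Type :=
| Const (c : nat)
| Cell (a : nat) (e : expr)
| Plus (e1 e2 : expr)
| Minus (e1 e2 : expr).

Fixpoint eval (s : state) (e : expr) : nat :=
  match e with
  | Const c => c
  | Cell a e => s a (eval s e)
  | Plus e1 e2 => (eval s e1 + eval s e2)
  | Minus e1 e2 => (eval s e1 - eval s e2)
  end.

Inductive com : Type :=
| Skip
| Assign (a : nat) (k e : expr)
| Query (x : nat) (e : expr) (a : nat)
| Seq (c1 c2 : com)
| If (e : expr) (c1 c2 : com)
| While (e : expr) (c : com).

(* The bundle whose characteristic vector is stored in array a. *)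
Definition bundle (m : nat) (s : state) (a : nat) : {set 'I_m} :=
  [set g : 'I_m | s a g != 0].

(* A query is v_i(S) for the agent numbered i. Memory cells hold natural
   numbers, hence the truncation, which loses nothing on binary valuations
   (lemma [binary_truncnK]). *)
Definition answer (R : realType) n m (v : profile R n m) (i : nat)
    (S : {set 'I_m}) : nat :=
  if insub i is Some j then Num.truncn (v j S) else 0.

(* [exec v c s t s']: with oracle v, the program c started in state s halts
   in state s' after t steps. Tests are true when nonzero. Expressions have a
   size fixed by the program, so evaluating one is part of a single step. *)
Inductive exec (R : realType) n m (v : profile R n m) :
    com -> state -> nat -> state -> Prop :=
| exec_skip s : exec v Skip s 1 s
| exec_assign a k e s :
    exec v (Assign a k e) s 1 (update s a (eval s k) (eval s e))
| exec_query x e a s :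
    exec v (Query x e a) s 1
      (update s x 0 (answer v (eval s e) (bundle m s a)))
| exec_seq c1 c2 s1 s2 s3 t1 t2 :
    exec v c1 s1 t1 s2 -> exec v c2 s2 t2 s3 ->
    exec v (Seq c1 c2) s1 (t1 + t2) s3
| exec_if_true e c1 c2 s s' t :
    eval s e != 0 -> exec v c1 s t s' -> exec v (If e c1 c2) s t.+1 s'
| exec_if_false e c1 c2 s s' t :
    eval s e = 0 -> exec v c2 s t s' -> exec v (If e c1 c2) s t.+1 s'
| exec_while_false e c s :
    eval s e = 0 -> exec v (While e c) s 1 s
| exec_while_true e c s1 s2 s3 t1 t2 :
    eval s1 e != 0 -> exec v c s1 t1 s2 -> exec v (While e c) s2 t2 s3 ->
    exec v (While e c) s1 (t1 + t2).+1 s3.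

(* Input: n in cell 0 of array 0, m in cell 0 of array 1. *)
Definition init (n m : nat) : state :=
  update (update (fun _ _ => 0) 0 0 n) 1 0 m.

(* Output: cell g of array 2 is the number of the agent who receives g. *)
Definition output (n m : nat) (s : state) : allocation n m :=
  fun i => [set g : 'I_m | s 2 g == i].

(* One program for all n and m, polynomial in n + m. *)
Definition polytime_computable (R : realType)
    (dom : forall n m, profile R n m -> Prop)
    (sol : forall n m, profile R n m -> allocation n m -> Prop) : Prop :=
  exists (alg : com) (c d : nat),
  forall n m (v : profile R n m), dom n m v ->
  exists (t : nat) (s : state),
    [/\ exec v alg (init n m) t s,
        (t <= c * (n + m).+1 ^ d) &
        sol n m v (@output n m s)].

Local Open Scope ring_scope.

Lemma binary_truncnK (R : realType) m (f : {set 'I_m} -> R) (S : {set 'I_m}) :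
  binary f -> (Num.truncn (f S))%:R = f S.
Proof.
move=> [f0 fS]; suff [k ->] : exists k : nat, f S = k%:R by rewrite natrK.
have [p] := ubnP #|S|; elim: p S => // p IHp S leSp.
have [->|[g gS]] := set_0Vmem S; first by exists 0%N.
have [|k fk] := IHp (S :\ g); first by move: leSp; rewrite (cardsD1 g) gS.
have /fS : g \notin S :\ g by rewrite !inE eqxx.
rewrite setD1K // fk => -[/subr0_eq ->|/eqP]; first by exists k.
by rewrite subr_eq addrC natr1 => /eqP ->; exists k.+1.
Qed.

(* Main.v *)
Require Import Defs.
From mathcomp Require Import all_boot all_order all_algebra.
From mathcomp Require Import reals.
From mathcomp Require Import zify.
From mathcomp Require boolp.

(* Keep a partial EFX allocation and take an unallocated item g. For every
   agent b consider the bundle A_b + g, and say that an agent wants a bundle if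
   it prefers it strictly to its own. If nobody wants A_b + g for some b, then
   giving g to b preserves EFX. Otherwise shrink A_b + g to a minimal wanted
   bundle S_b, and let f(b) be an agent who wants S_b. The map f has a cycle C.
   For b in C give S_b to f(b), except that only one of them can contain g: the
   others become S_b - g; the remaining items are returned. Marginals being at
   most 1, an agent who receives S_b - g loses nothing compared with its old
   bundle, and at least one agent gains; minimality of the S_b keeps the
   allocation EFX. Hence each round either raises the total value, or keeps it
   from falling and allocates one more item, so O(n m^2) rounds suffice. *)

Set Implicit Arguments.
Unset Strict Implicit.
Unset Printing Implicit Defensive.

(** Allocations are kept as raw owner arrays. The owner [n] marks an unallocated item, so
    [part m o n] is the pool. *)
Definition part (m : nat) (o : nat -> nat) (b : nat) : {set 'I_m} :=
  [set h : 'I_m | o h == b].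

(** * Oracle answers as natural-number valuations *)

Section Answers.

Import Order.TTheory GRing.Theory Num.Theory.

Variables (R : realType) (n m : nat) (v : profile R n m).
Hypothesis v_binary : binary_profile v.

Lemma answerE (i : 'I_n) S : ((answer v i S)%:R = v i S)%R.
Proof.
rewrite /answer; case: insubP => [j _ /val_inj->|/negP[]//].
exact: binary_truncnK.
Qed.

Lemma answer0 i : answer v i set0 = 0.
Proof.
by rewrite /answer; case: insub => // j; rewrite (v_binary j).1 truncn0.
Qed.

(** Beyond [n] the answer is the default 0, so the bounds hold for every natural number [i] and
    agents can be indexed by plain naturals from here on. *)
Lemma answer_setU1 i g S :
  answer v i S <= answer v i (g |: S) <= (answer v i S).+1.
Proof.
have [gS|gS] := boolP (g \in S).
  by rewrite (setUidPr _) ?sub1set // leqnn leqnSn.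
case: (ltnP i n) => [lt_in|le_ni]; last by rewrite /answer insubN // -leqNgt.
have [_ /(_ S g gS)] := v_binary (Ordinal lt_in).
rewrite -!answerE /= => -[/subr0_eq/eqP|/eqP].
  by rewrite eqr_nat => /eqP->; rewrite leqnn leqnSn.
by rewrite subr_eq addrC natr1 eqr_nat => /eqP->; rewrite leqnn leqnSn.
Qed.

Lemma EFX_output s :
  (forall i j (h : 'I_m), i < n -> j < n -> h \in part m (s 2) j ->
     answer v i (part m (s 2) j :\ h) <= answer v i (part m (s 2) i)) ->
  (forall h, h < m -> s 2 h < n) -> EFX_allocation v (@output n m s).
Proof.
move=> efx own; split; last first.
  by move=> i j g gj; rewrite -!answerE ler_nat efx.
split=> [|i j].
  apply/setP=> g; rewrite !inE; apply/bigcupP.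
  by exists (Ordinal (own g (ltn_ord g))); rewrite ?inE.
apply: contraR => /pred0Pn[g] /=; rewrite !inE => /andP[/eqP-> /eqP ij].
exact/eqP/val_inj.
Qed.

End Answers.

(** * The two improving moves and the potential *)

Section Improvement.

Variables (n m : nat) (u : nat -> {set 'I_m} -> nat).
Hypothesis u0 : forall i, u i set0 = 0.
Hypothesis u_setU1 : forall i g S, u i S <= u i (g |: S) <= (u i S).+1.

Lemma value_mono i (A B : {set 'I_m}) : A \subset B -> u i A <= u i B.
Proof.
have [p] := ubnP #|B :\: A|; elim: p B => // p IHp B cardB sAB.
have [/eqP|[g gBA]] := set_0Vmem (B :\: A).
  by rewrite setD_eq0 => sBA;
    rewrite (_ : A = B) //; apply/eqP; rewrite eqEsubset sAB.
move: (gBA); rewrite inE => /andP[gA gB]; rewrite -(setD1K gB).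
apply: leq_trans (proj1 (andP (u_setU1 i g _))); apply: IHp.
  by move: cardB; rewrite (cardsD1 g) gBA setDDl setUC -setDDl.
by rewrite subsetD1 sAB.
Qed.

Lemma value_setD1 i g (A : {set 'I_m}) : u i A <= (u i (A :\ g)).+1.
Proof.
have [gA|gA] := boolP (g \in A); last first.
  by rewrite leqW // value_mono // subsetD1 subxx.
by rewrite -{1}(setD1K gA); case/andP: (u_setU1 i g (A :\ g)).
Qed.

Lemma value_card i (A : {set 'I_m}) : u i A <= #|A|.
Proof.
have [p] := ubnP #|A|; elim: p A => // p IHp A cardA.
have [->|[g gA]] := set_0Vmem A; first by rewrite u0.
rewrite (leq_trans (value_setD1 i g A)) // (cardsD1 g) gA ltnS IHp //.
by move: cardA; rewrite (cardsD1 g) gA.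
Qed.

Definition EFX_owner (o : nat -> nat) :=
  forall i j (h : 'I_m), i < n -> j < n -> h \in part m o j ->
    u i (part m o j :\ h) <= u i (part m o i).

Definition welfare (o : nat -> nat) := \sum_(i < n) u i (part m o i).

(** Encodes the lexicographic order on welfare and number of allocated items: the latter is at most
    [m], so one unit of welfare outweighs it. *)
Definition potential (o : nat -> nat) :=
  welfare o * m.+1 + #|[set h : 'I_m | o h < n]|.

Lemma potential_bound o : potential o <= n * m * m.+1 + m.
Proof.
rewrite leq_add // ?leq_mul //; last by rewrite -[leqRHS]card_ord max_card.
rewrite /welfare -[n in n * m]card_ord -sum_nat_const leq_sum // => i _.
by rewrite (leq_trans (value_card _ _)) // -[leqRHS]card_ord max_card.
Qed.

Lemma potential_welfare o o' : welfare o < welfare o' -> potential o < potential o'.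
Proof.
move=> lt_w; rewrite /potential.
have : #|[set h : 'I_m | o h < n]| <= m by rewrite -[leqRHS]card_ord max_card.
nia.
Qed.

Definition wanted (w : nat -> nat) (S : {set 'I_m}) :=
  exists2 a, a < n & w a < u a S.

(** For monotone values, single deletions account for all proper subsets. [S] itself may be
    unwanted. *)
Definition minimal (w : nat -> nat) (S : {set 'I_m}) :=
  forall a (h : 'I_m), a < n -> h \in S -> u a (S :\ h) <= w a.

(** No value falls and only the bundle of [b] changes, so new envy could only be of
    [g |: part m o b], which nobody prefers to their own bundle. Welfare does not fall, while [g]
    leaves the pool. *)
Lemma add_item (o o' : nat -> nat) (g : 'I_m) b : b < n -> o g = n ->
  (forall h : 'I_m, o' h = if h == g then b else o h) ->
  (forall a, a < n -> u a (g |: part m o b) <= u a (part m o a)) ->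
  EFX_owner o -> EFX_owner o' /\ potential o < potential o'.
Proof.
move=> lt_bn og o'E unwanted efx.
have partb : part m o' b = g |: part m o b.
  by apply/setP=> h; rewrite !inE o'E; have [//|] := eqVneq h g; rewrite ?eqxx.
have partNb a : a < n -> a != b -> part m o' a = part m o a.
  move=> lt_an neq_ab; apply/setP=> h; rewrite !inE o'E.
  have [->|//] := eqVneq h g.
  by rewrite og eq_sym (negPf neq_ab) gtn_eqF.
have mono a : a < n -> u a (part m o a) <= u a (part m o' a).
  move=> lt_an; have [->|neq] := eqVneq a b; last by rewrite partNb.
  by rewrite partb value_mono ?subsetUr.
split=> [i j h lt_in lt_jn|].
  apply: contraTT; rewrite -ltnNge => /(leq_ltn_trans (mono _ lt_in)).
  have [->|neq] := eqVneq j b; last first.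
    by rewrite partNb //; apply: contraTN => /efx h_ok; rewrite -leqNgt h_ok.
  rewrite partb ltnNge (leq_trans _ (unwanted _ lt_in)) //.
  by rewrite value_mono ?subsetDl.
rewrite /potential -addnS leq_add ?leq_mul2r ?leq_sum //=.
  by move=> i _; apply: mono.
apply: proper_card; apply/properP; split.
  by apply/subsetP=> h; rewrite !inE o'E; case: eqP => // _ _.
by exists g; rewrite !inE ?o'E ?eqxx // og ltnn.
Qed.

(** An agent on [C] gets [S b] in full, a strict gain, or misses only [g], which costs at most the
    unit gained. So no value falls, and envy of a new bundle would make some [S b :\ h] worth more
    than an old bundle, against minimality. The agent [f d] gains outright, which outweighs all
    items returned to the pool. *)
Lemma rotate_bundles (o o' : nat -> nat) (g : 'I_m) (f : nat -> nat) (C : pred nat)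
    (S : nat -> {set 'I_m}) :
  (forall b, C b -> f b < n) ->
  (forall b, C b -> u (f b) (part m o (f b)) < u (f b) (S b)) ->
  (forall b, C b -> minimal (fun a => u a (part m o a)) (S b)) ->
  (forall a, C a -> exists2 b, C b & f b = a) ->
  (forall b, C b -> part m o' (f b) = S b \/ part m o' (f b) = S b :\ g) ->
  (exists2 b, C b & part m o' (f b) = S b) ->
  (forall a, a < n -> ~~ C a -> part m o' a = part m o a) ->
  EFX_owner o -> EFX_owner o' /\ potential o < potential o'.
Proof.
move=> lt_fn want minS surj moved [d Cd part_d] fixed efx.
have mono a : a < n -> u a (part m o a) <= u a (part m o' a).
  move=> lt_an; have [/surj[b Cb <-]|nCa] := boolP (C a); last by rewrite fixed.
  have [->|->] := moved _ Cb; first exact/ltnW/want.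
  by rewrite -ltnS (leq_trans (want _ Cb)) ?value_setD1.
split=> [i j h lt_in lt_jn hj|].
  apply: leq_trans (mono _ lt_in).
  have [/surj[b Cb fb]|nCj] := boolP (C j); last first.
    by move: hj; rewrite fixed // => /efx->.
  move: hj; rewrite -fb; have [->|->] := moved _ Cb => hS; first exact: minS.
  apply: leq_trans (minS _ Cb _ h lt_in _); last by case/setD1P: hS.
  by rewrite value_mono // setSD ?subsetDl.
apply: potential_welfare; rewrite /welfare (bigD1 (Ordinal (lt_fn _ Cd))) //=.
rewrite [ltnRHS](bigD1 (Ordinal (lt_fn _ Cd))) //= part_d.
rewrite -addSn leq_add ?want // leq_sum // => i _; exact: mono.
Qed.

End Improvement.

(** * The cycle reached by iterating a map from 0 *)

Section EventualCycle.

Variables (n : nat) (f : nat -> nat).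
Hypothesis f_lt : forall b, b < n -> f b < n.

(** After [n] steps the orbit of 0 has entered its cycle, of length at most [n], so the next [n]
    iterates cover the cycle, possibly with repetitions. *)
Definition limit_cycle := [seq iter (n + k.+1) f 0 | k <- iota 0 n].

(** By the pigeonhole principle [iter n f 0] equals an earlier [iter i f 0]; take [p = n - i]. The
    condition [n <= k + p] then says that [k] is at least [i], past the tail of the orbit. *)
Lemma limit_cycle_period : 0 < n -> exists2 p, 0 < p <= n &
  forall k, n <= k + p -> iter (k + p) f 0 = iter k f 0.
Proof.
move=> n_gt0; have iter_lt k : iter k f 0 < n by elim: k => //= k /f_lt.
have: looping f 0 n.
  apply/negPn; rewrite -looping_uniq; apply/negP=> /uniq_leq_size.
  move=> /(_ (iota 0 n)); rewrite size_traject size_iota ltnn => sub.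
  apply: notF; apply: sub => b.
  by case/trajectP=> [k _ ->]; rewrite mem_iota iter_lt.
case/trajectP=> i lt_in iterE; exists (n - i) => [|k le_nk].
  by rewrite subn_gt0 lt_in leq_subr.
have -> : k + (n - i) = (k - i) + n by lia.
by rewrite iterD iterE -iterD subnK //; lia.
Qed.

(** An index above [2n] stays above [n] when the period, at most [n], is subtracted, so it can be
    brought down to the range listed. *)
Lemma limit_cycleP b : 0 < n ->
  reflect (exists2 k, n < k & b = iter k f 0) (b \in limit_cycle).
Proof.
move=> n_gt0; apply: (iffP mapP) => [[k _ ->]|[k lt_nk ->]].
  by exists (n + k.+1); rewrite // addnS ltnS leq_addr.
have [p /andP[p_gt0 le_pn] per] := limit_cycle_period n_gt0.
elim/ltn_ind: k lt_nk => k IHk lt_nk.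
have [le_k|gt_k] := leqP k (n + n).
  exists (k - n.+1); first by rewrite mem_iota; lia.
  by congr (iter _ f 0); lia.
have [||q q_in e] := IHk (k - p); [lia|lia|exists q => //].
by rewrite -e -{1}(subnK (_ : p <= k)) ?per //; lia.
Qed.

Lemma limit_cycle_lt b : b \in limit_cycle -> b < n.
Proof.
case: (posnP n) => [n0|n_gt0]; first by rewrite /limit_cycle n0.
by case/limit_cycleP=> // k _ ->; elim: k => //= k /f_lt.
Qed.

Lemma limit_cycle_next b : 0 < n -> b \in limit_cycle -> f b \in limit_cycle.
Proof.
move=> n_gt0 /limit_cycleP[]// k lt_nk ->; apply/limit_cycleP => //.
by exists k.+1; rewrite // leqW.
Qed.

(** One period serves the whole cycle, so [iter p f] inverts [f] there; surjectivity and injectivity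
    on the cycle follow. *)
Lemma limit_cycle_iter : 0 < n -> exists p, forall b,
  b \in limit_cycle -> iter p.+1 f b = b.
Proof.
move=> n_gt0; have [p /andP[p_gt0 _] per] := limit_cycle_period n_gt0.
exists p.-1 => b /limit_cycleP[]// k lt_nk ->.
by rewrite -iterD prednK // addnC per //; lia.
Qed.

Lemma limit_cycle_surj a : 0 < n -> a \in limit_cycle ->
  exists2 b, b \in limit_cycle & f b = a.
Proof.
move=> n_gt0 aC; have [p per] := limit_cycle_iter n_gt0.
exists (iter p f a); last by rewrite -iterS per.
by elim: p {per} => //= p; apply: limit_cycle_next.
Qed.

Lemma limit_cycle_inj : 0 < n -> {in limit_cycle &, injective f}.
Proof.
move=> n_gt0 a b aC bC fab; have [p per] := limit_cycle_iter n_gt0.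
by rewrite -(per a) // -(per b) // !iterSr fab.
Qed.

End EventualCycle.

(** * A language of bounded loops, its cost and its compilation *)

Inductive bound := Agents | Items | Total.

Definition bound_expr (b : bound) : expr :=
  match b with
  | Agents => Cell 0 (Const 0)
  | Items => Cell 1 (Const 0)
  | Total => Plus (Plus (Cell 0 (Const 0)) (Cell 1 (Const 0))) (Const 1)
  end.

(* All loops are bounded by the size of the input, so these programs have a
   functional semantics and run in polynomial time by construction. *)
Inductive prog : Type :=
| PSkip
| PAssign (a : nat) (k e : expr)
| PQuery (x : nat) (e : expr) (a : nat)
| PSeq (p q : prog)
| PIf (e : expr) (p q : prog)
| PFor (i : nat) (b : bound) (p : prog).

Definition var (a : nat) : expr := Cell a (Const 0).
Definition set_var (a : nat) (e : expr) : prog := PAssign a (Const 0) e.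

Fixpoint compile (p : prog) : com :=
  match p with
  | PSkip => Skip
  | PAssign a k e => Assign a k e
  | PQuery x e a => Query x e a
  | PSeq p q => Seq (compile p) (compile q)
  | PIf e p q => If e (compile p) (compile q)
  | PFor i b p =>
      Seq (Assign i (Const 0) (Const 0))
          (While (Minus (bound_expr b) (var i))
                 (Seq (compile p) (Assign i (Const 0) (Plus (var i) (Const 1)))))
  end.

Fixpoint writes (p : prog) : seq nat :=
  match p with
  | PSkip => [::]
  | PAssign a _ _ => [:: a]
  | PQuery x _ _ => [:: x]
  | PSeq p q => writes p ++ writes q
  | PIf _ p q => writes p ++ writes q
  | PFor i _ p => i :: writes p
  end.

(* Writing to the input (arrays 0 and 1) could change the loop bounds. *)
Fixpoint well_formed (p : prog) : bool :=
  match p with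
  | PSkip => true
  | PAssign a _ _ => 1 < a
  | PQuery x _ _ => 1 < x
  | PSeq p q => well_formed p && well_formed q
  | PIf _ p q => well_formed p && well_formed q
  | PFor i _ p => [&& 1 < i, i \notin writes p & well_formed p]
  end.

(** An upper bound: both branches of a conditional are charged and each loop is taken [N] times. A
    loop pays 2 for its initialisation and last test, and 2 per round for test and increment. *)
Fixpoint cost (N : nat) (p : prog) : nat :=
  match p with
  | PSkip | PAssign _ _ _ | PQuery _ _ _ => 1
  | PSeq p q => cost N p + cost N q
  | PIf _ p q => (cost N p + cost N q).+1
  | PFor _ _ p => 2 + N * (cost N p + 2)
  end.

Lemma cost_poly p : exists c d, forall N, 0 < N -> cost N p <= c * N ^ d.
Proof.
have lift (c d e N : nat) : 0 < N -> d <= e -> c * N ^ d <= c * N ^ e.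
  by move=> N_gt0 le_de; rewrite leq_mul // leq_pexp2l.
have add (p1 p2 : prog) :
    (exists c d, forall N, 0 < N -> cost N p1 <= c * N ^ d) ->
    (exists c d, forall N, 0 < N -> cost N p2 <= c * N ^ d) ->
    exists c d, forall N, 0 < N -> (cost N p1 + cost N p2).+1 <= c * N ^ d.
  move=> [c1 [d1 H1]] [c2 [d2 H2]]; exists (c1 + c2 + 1), (d1 + d2) => N N_gt0.
  rewrite !mulnDl -addn1 !leq_add ?mul1n ?expn_gt0 ?N_gt0 //.
    by rewrite (leq_trans (H1 N N_gt0)) ?lift ?leq_addr.
  by rewrite (leq_trans (H2 N N_gt0)) ?lift ?leq_addl.
elim: p => [|a k e|x e a|p IHp q IHq|e p IHp q IHq|i b p [c [d IH]]] /=.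
- by exists 1, 0.
- by exists 1, 0.
- by exists 1, 0.
- have [c [d H]] := add _ _ IHp IHq; exists c, d => N /H; exact: ltnW.
- exact: add.
(* The summands [2 * N] and 2 are each at most [2 * N ^ d.+1], which accounts for the 4. *)
- exists (c + 4), d.+1 => N N_gt0; rewrite expnS.
  have := IH N N_gt0; have : 0 < N ^ d by rewrite expn_gt0 N_gt0.
  set x := N ^ d; set y := cost N p; nia.
Qed.

Section Semantics.

Variables (R : realType) (n m : nat) (v : profile R n m).

Definition bound_val (b : bound) : nat :=
  match b with Agents => n | Items => m | Total => (n + m).+1 end.

(** The loop sets its counter to [k.+1] outright; this agrees with the compiled increment because a
    well-formed body does not write [i]. *)
Fixpoint run (p : prog) (s : state) : state :=
  match p with
  | PSkip => s
  | PAssign a k e => update s a (eval s k) (eval s e)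
  | PQuery x e a => update s x 0 (answer v (eval s e) (bundle m s a))
  | PSeq p q => run q (run p s)
  | PIf e p q => if eval s e != 0 then run p s else run q s
  | PFor i b p =>
      iteri (bound_val b) (fun k s => update (run p s) i 0 k.+1) (update s i 0 0)
  end.

Lemma update_other s a k x b : b != a -> update s a k x b = s b.
Proof. by rewrite /update => /negPf->; apply: boolp.funext. Qed.

Lemma update_same s a k x l : update s a k x a l = if l == k then x else s a l.
Proof. by rewrite /update eqxx. Qed.

Lemma run_frame p s a : a \notin writes p -> run p s a = s a.
Proof.
elim: p s => [|b j e|x e b|p IHp q IHq|e p IHp q IHq|i b p IHp] s //=.
- by rewrite inE => ?; rewrite update_other.
- by rewrite inE => ?; rewrite update_other.
- by rewrite mem_cat negb_or => /andP[ap aq]; rewrite IHq // IHp.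
- by rewrite mem_cat negb_or => /andP[ap aq]; case: ifP; rewrite ?IHq ?IHp.
- rewrite inE negb_or => /andP[ai ap].
  elim: (bound_val b) => [|N IHN] /=; first by rewrite update_other.
  by rewrite update_other // IHp.
Qed.

(** The invariant rule for the program loops below. The induction carries the counter and the frame
    along with [P], so an invariant need only mention what the loop changes. *)
Lemma for_ind (P : nat -> state -> Prop) i b p s :
  i \notin writes p ->
  P 0 (update s i 0 0) ->
  (forall k t, k < bound_val b -> t i 0 = k ->
     (forall a, a \notin i :: writes p -> t a = s a) -> P k t ->
     P k.+1 (update (run p t) i 0 k.+1)) ->
  P (bound_val b) (run (PFor i b p) s).
Proof.
move=> ip P0 PS /=; move: (bound_val b) PS => N PS.
set st := iteri _ _ _.
suff: [/\ st i 0 = N, forall a, a \notin i :: writes p -> st a = s a & P N st].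
  by case.
rewrite /st {st}; elim: N PS => [|N IHN] PS /=.
  rewrite update_same eqxx; split=> // a; rewrite inE negb_or => /andP[ai _].
  by rewrite update_other.
have [|eN frN PN] := IHN; first by move=> k t lt_kN; apply: PS; apply: leqW.
split; [by rewrite update_same eqxx | move=> a a_p | exact: PS].
have := frN a a_p; move: a_p; rewrite inE negb_or => /andP[ai ap].
by rewrite update_other ?run_frame.
Qed.

Lemma compile_correct p s : well_formed p -> s 0 0 = n -> s 1 0 = m ->
  exists2 t, exec v (compile p) s t (run p s) & t <= cost (n + m).+1 p.
Proof.
have input_kept q a : well_formed q -> a < 2 -> a \notin writes q.
  move=> + lt_a2; elim: q => [|b j e|x e b|p1 IH1 p2 IH2|e p1 IH1 p2 IH2|i b q IHq] //=.
  - by rewrite inE; lia.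
  - by rewrite inE; lia.
  - by case/andP=> w1 w2; rewrite mem_cat negb_or IH1 ?IH2.
  - by case/andP=> w1 w2; rewrite mem_cat negb_or IH1 ?IH2.
  - by case/and3P=> lt_1i _ wq; rewrite inE negb_or IHq // andbT; lia.
elim: p s => [|a k e|x e a|p IHp q IHq|e p IHp q IHq|i b p IHp] s /=.
- by exists 1; first constructor.
- by exists 1; first constructor.
- by exists 1; first constructor.
- case/andP=> wp wq s0 s1; have [t1 ex1 le1] := IHp s wp s0 s1.
  have [||t2 ex2 le2] := IHq (run p s) wq; rewrite ?run_frame ?input_kept //.
  by exists (t1 + t2); [apply: exec_seq ex1 ex2 | apply: leq_add].
- case/andP=> wp wq s0 s1.
  have [t1 ex1 le1] := IHp s wp s0 s1; have [t2 ex2 le2] := IHq s wq s0 s1.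
  case: eqP => /= [e0|/eqP e0].
    by exists t2.+1; [apply: exec_if_false | rewrite ltnS (leq_trans le2) ?leq_addl].
  by exists t1.+1; [apply: exec_if_true | rewrite ltnS (leq_trans le1) ?leq_addr].
case/and3P=> lt_1i ip wp s0 s1; set N := (n + m).+1.
set body := fun k s => update (run p s) i 0 k.+1.
have le_bN : bound_val b <= N by case: b; rewrite /bound_val /N; lia.
have bval (t : state) : t 0 0 = n -> t 1 0 = m -> eval t (bound_expr b) = bound_val b.
  by move=> t0 t1; case: b {le_bN} => /=; rewrite ?t0 ?t1 //; lia.
set t0 := update s i 0 0.
have inv k : [/\ iteri k body t0 i 0 = k, iteri k body t0 0 0 = n
               & iteri k body t0 1 0 = m].
  elim: k => [|k [_ k0 k1]] /=; rewrite /t0 /body update_same eqxx.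
    by rewrite !update_other //; lia.
  by rewrite !update_other ?run_frame ?input_kept //; lia.
(* Here [k] counts the rounds still to come: [exec] peels a [While] from its first round, whereas
   [iteri] adds rounds at the end. *)
suff loop k : k <= bound_val b -> exists2 t,
    exec v (While (Minus (bound_expr b) (var i))
              (Seq (compile p) (Assign i (Const 0) (Plus (var i) (Const 1)))))
         (iteri (bound_val b - k) body t0) t (iteri (bound_val b) body t0)
    & t <= 1 + k * (cost N p + 2).
  have [|t ex le_t] := loop (bound_val b); first by [].
  exists (1 + t); last first.
    have : bound_val b * (cost N p + 2) <= N * (cost N p + 2).
      by rewrite leq_mul2r le_bN orbT.
    by lia.
  apply: exec_seq; first exact: exec_assign.
  by move: ex; rewrite subnn.
elim: k => [|k IHk] le_kb.
  exists 1 => //; rewrite subn0; apply: exec_while_false.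
  by have [i0 k0 k1] := inv (bound_val b); rewrite /= bval // i0 subnn.
have [t ex le_t] := IHk (ltnW le_kb).
set j := bound_val b - k.+1; have [j_i j0 j1] := inv j.
have [t1 ex1 le1] := IHp (iteri j body t0) wp j0 j1.
exists ((t1 + 1) + t).+1; last by rewrite mulSn -/N in le1 *; lia.
apply: exec_while_true (exec_seq ex1 (exec_assign _ _ _ _ _)) _.
  by rewrite /= bval // j_i /j; lia.
move: ex; have -> : bound_val b - k = j.+1 by rewrite /j; lia.
by rewrite /= run_frame // j_i addn1.
Qed.

End Semantics.

(** * The program *)

(* Arrays [pool], [reply], [fan], [saved], [addee], [cur], [last] and the loop
   counters are scalar variables. [on] marks the cycle, [keep] the items of A_b
   which belong to S_b, and [takes] the agents b with g in S_b. *)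
Local Notation owner := 2 (only parsing).
Local Notation pool := 3 (only parsing).
Local Notation cand := 4 (only parsing).
Local Notation value := 5 (only parsing).
Local Notation reply := 6 (only parsing).
Local Notation fan := 7 (only parsing).
Local Notation saved := 8 (only parsing).
Local Notation next := 9 (only parsing).
Local Notation keep := 10 (only parsing).
Local Notation takes := 11 (only parsing).
Local Notation addee := 12 (only parsing).
Local Notation cur := 13 (only parsing).
Local Notation on := 14 (only parsing).
Local Notation last := 15 (only parsing).
Local Notation ia := 16 (only parsing).
Local Notation ih := 17 (only parsing).
Local Notation ib := 18 (only parsing).
Local Notation ik := 19 (only parsing).

Local Notation "p ;; q" := (PSeq p q) (at level 61, right associativity).
Local Notation succ e := (Plus e (Const 1)).
Local Notation pred e := (Minus e (Const 1)).
(** With truncated subtraction this is the absolute difference, and 1 minus it is the indicator of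
    equality. *)
Local Notation neqe e1 e2 := (Plus (Minus e1 e2) (Minus e2 e1)).

(* Stored indices of agents and items are shifted by one in [pool], [fan],
   [addee] and [last], where 0 means none. *)

Definition load (b : nat) : prog :=
  PFor ih Items
    (PAssign cand (var ih)
       (Minus (Const 1) (neqe (Cell owner (var ih)) (var b)))).

Definition find_fan : prog :=
  set_var fan (Const 0) ;;
  PFor ia Agents
    (PQuery reply (var ia) cand ;;
     PIf (Minus (var reply) (Cell value (var ia)))
         (set_var fan (succ (var ia))) PSkip).

Definition shrink : prog :=
  PFor ih Items
    (set_var saved (Cell cand (var ih)) ;;
     PAssign cand (var ih) (Const 0) ;;
     find_fan ;;
     PIf (var fan) PSkip (PAssign cand (var ih) (var saved))).

(** The old bundles are disjoint, so one array indexed by items holds all the sets [S_b] apart from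
    [g]. *)
Definition save_cand : prog :=
  PFor ih Items
    (PIf (neqe (Cell owner (var ih)) (var ib)) PSkip
         (PAssign keep (var ih) (Cell cand (var ih)))).

(** If the shrunk bundle has no fan, nobody wanted the full one either and [addee] records [b]. The
    0 then stored in [next] is a dummy, as the round ends by adding the item. *)
Definition choose : prog :=
  load ib ;;
  PAssign cand (pred (var pool)) (Const 1) ;;
  shrink ;;
  find_fan ;;
  PIf (var fan) PSkip (set_var addee (succ (var ib))) ;;
  PAssign next (var ib) (pred (var fan)) ;;
  PAssign takes (var ib) (Cell cand (pred (var pool))) ;;
  save_cand.

Definition choices : prog :=
  set_var addee (Const 0) ;; PFor ib Agents choose.

(** The first loop walks past the tail. Clearing [on] up to [Total] includes index [n], at which
    [rotate] reads it for items in the pool. [last] remembers a cycle agent whose [S_b] contains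
    [g], if any. *)
Definition find_cycle : prog :=
  set_var cur (Const 0) ;;
  PFor ik Agents (set_var cur (Cell next (var cur))) ;;
  PFor ik Total (PAssign on (var ik) (Const 0)) ;;
  set_var last (Const 0) ;;
  PFor ik Agents
    (set_var cur (Cell next (var cur)) ;;
     PAssign on (var cur) (Const 1) ;;
     PIf (Cell takes (var cur)) (set_var last (succ (var cur))) PSkip).

(** [var 0] is [n], the mark of the pool. The loop leaves [g] alone since [n] is off the cycle;
    afterwards [g] joins at most one bundle, that of [last]. *)
Definition rotate : prog :=
  PFor ih Items
    (PIf (Cell on (Cell owner (var ih)))
         (PIf (Cell keep (var ih))
              (PAssign owner (var ih) (Cell next (Cell owner (var ih))))
              (PAssign owner (var ih) (var 0)))
         PSkip) ;;
  PIf (var last)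
      (PAssign owner (pred (var pool)) (Cell next (pred (var last)))) PSkip.

Definition find_pool : prog :=
  set_var pool (Const 0) ;;
  PFor ih Items
    (PIf (neqe (Cell owner (var ih)) (var 0)) PSkip
         (set_var pool (succ (var ih)))).

Definition values : prog :=
  PFor ib Agents
    (load ib ;; PQuery reply (var ib) cand ;; PAssign value (var ib) (var reply)).

Definition improve : prog :=
  find_pool ;;
  PIf (var pool)
    (values ;; choices ;;
     PIf (var addee)
         (PAssign owner (pred (var pool)) (pred (var addee)))
         (find_cycle ;; rotate))
    PSkip.

(** The nested loops give [(n + m).+1 ^ 3] rounds, more than the potential can rise. Surplus rounds
    find an empty pool and keep the allocation. *)
Definition efx_prog : prog :=
  PFor ih Items (PAssign owner (var ih) (var 0)) ;;
  PFor 20 Total (PFor 21 Total (PFor 22 Total improve)).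

(** * Correctness of the program *)

Section Correctness.

Variables (R : realType) (n m : nat) (v : profile R n m).

Local Notation u := (answer v).
Local Notation run := (run v).

Lemma run_seq p q s : run (p ;; q) s = run q (run p s).
Proof. by []. Qed.

Lemma run_if e p q s :
  run (PIf e p q) s = if eval s e != 0 then run p s else run q s.
Proof. by []. Qed.

Lemma neqe_eq a b : (a - b + (b - a) == 0) = (a == b).
Proof. lia. Qed.

Lemma bundle_load b s : b \notin [:: cand; ih] ->
  bundle m (run (load b) s) cand = part m (s owner) (s b 0).
Proof.
rewrite !inE !negb_or => /andP[b_cand b_ih].
suff H : forall h, h < m -> run (load b) s cand h = (s owner h == s b 0).
  by apply/setP=> h; rewrite !inE H // eqb0 negbK.
pose P k (t : state) := forall h, h < k -> t cand h = (s owner h == s b 0).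
apply: (@for_ind _ n m v P ih Items) => //= k t _ tk fr IH h.
rewrite ltnS leq_eqVlt /update /= tk (fr owner) // (fr b) ?inE ?negb_or ?b_ih //.
have [-> _|_ /IH //] := eqVneq h k; lia.
Qed.

Lemma find_fanP s : let X := bundle m s cand in
  if run find_fan s fan 0 is a.+1 then a < n /\ s value a < u a X
  else forall a, a < n -> u a X <= s value a.
Proof.
move=> X; pose P k (t : state) :=
  if t fan 0 is a.+1 then a < n /\ s value a < u a X
  else forall a, a < k -> u a X <= s value a.
suff: P n (run find_fan s) by [].
rewrite /find_fan run_seq; apply: (@for_ind _ n m v P ia Agents) => //=.
move=> k t lt_kn tk fr IH.
rewrite /update /= tk /P /= (fr value) //.
have -> : bundle m t cand = X by rewrite /X /bundle fr.
case: ifP => /= [|/negbFE/eqP le_uX].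
  by rewrite addn1 subn_eq0 -ltnNge.
move: IH; rewrite /P /=; case: (t fan 0) => // IH a.
rewrite ltnS leq_eqVlt => /predU1P[->|]; last exact: IH.
by rewrite -subn_eq0 le_uX.
Qed.

Lemma fanP s : let X := bundle m s cand in
  reflect (wanted n u (s value) X) (run find_fan s fan 0 != 0).
Proof.
move=> X; have := find_fanP s; rewrite -/X.
case: (run find_fan s fan 0) => [|a] /= H; constructor.
  by case=> a /H; rewrite leqNgt => /negP.
by case: H => lt_an; exists a.
Qed.

Lemma unwantedP s a : run find_fan s fan 0 = 0 -> a < n ->
  u a (bundle m s cand) <= s value a.
Proof. by have := find_fanP s; move=> + fan0; rewrite fan0; apply. Qed.

Hypothesis v_binary : binary_profile v.

(** One greedy pass is enough: if deleting an item leaves a bundle that nobody wants, then by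
    monotonicity the same deletion from any later, smaller bundle does so too. *)
Lemma shrinkP s :
  let X := bundle m s cand in let Y := bundle m (run shrink s) cand in
  [/\ Y \subset X, wanted n u (s value) X -> wanted n u (s value) Y
    & minimal n u (s value) Y].
Proof.
move=> X Y; pose P k (t : state) := let Z := bundle m t cand in
  [/\ Z \subset X, wanted n u (s value) X -> wanted n u (s value) Z
    & forall a (h : 'I_m), a < n -> h < k -> h \in Z -> u a (Z :\ h) <= s value a].
suff [? ? minY] : P m (run shrink s) by split=> // a h ? ?; apply: minY.
apply: (@for_ind _ n m v P ih Items) => //= k t lt_km tk fr [sZX wZ minZ].
set Z := bundle m t cand in sZX wZ minZ *.
set t1 := update _ cand _ _; pose g := Ordinal (lt_km : k < m).
have t1E : bundle m t1 cand = Z :\ g.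
  apply/setP=> h; rewrite !inE /t1 /update /= tk.
  by rewrite -[h == g]val_eqE /=; case: (_ == k).
have t1v : t1 value = s value by rewrite /t1 !update_other // fr.
rewrite /P; case: ifP => [/fanP|/negbFE/eqP nofan].
  rewrite t1E t1v => wZg.
  have -> : bundle m (update (run find_fan t1) ih 0 k.+1) cand = Z :\ g.
    by rewrite -t1E /bundle update_other // run_frame.
  split=> // [|a h lt_an]; first exact: subset_trans (subsetDl _ _) sZX.
  rewrite ltnS leq_eqVlt => /orP[/eqP hk|lt_hk] hZ.
    by move: hZ; rewrite -[h](_ : g = h) ?inE ?eqxx //; apply: val_inj.
  apply: leq_trans (minZ a h lt_an lt_hk _); last by case/setD1P: hZ.
  by apply: value_mono => [i g' S|]; [exact: answer_setU1 | rewrite setSD ?subsetDl].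
have -> : bundle m (update (update (run find_fan t1) cand
    (run find_fan t1 ih 0) (run find_fan t1 saved 0)) ih 0 k.+1) cand = Z.
  apply/setP=> h; rewrite !inE update_other // update_same !run_frame //.
  by rewrite /t1 /update /= tk; have [->|] := eqVneq (h : nat) k.
split=> // a h lt_an; rewrite ltnS leq_eqVlt => /orP[/eqP hk|]; last exact: minZ.
move=> _; rewrite (_ : h = g); last exact: val_inj.
by rewrite -t1E -t1v unwantedP.
Qed.

Lemma save_candP s h : run save_cand s keep h =
  if (h < m) && (s owner h == s ib 0) then s cand h else s keep h.
Proof.
pose P k (t : state) := forall h, t keep h =
  if (h < k) && (s owner h == s ib 0) then s cand h else s keep h.
suff: P m (run save_cand s) by apply.
apply: (@for_ind _ n m v P ih Items) => //= k t _ tk fr IH {}h.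
rewrite tk !(fr owner, fr ib, fr cand) // neqe_eq ltnS leq_eqVlt.
have [ok|nok] /= := eqVneq (s owner k) (s ib 0); rewrite /update /= ?tk IH.
  by have [->|] := eqVneq h k; rewrite ?ok ?eqxx.
by have [->|] := eqVneq h k; rewrite ?(negPf nok) ?andbF.
Qed.

Definition chosen (o w : nat -> nat) (g : 'I_m) (b : nat) (S : {set 'I_m})
    (t : state) :=
  [/\ S \subset g |: part m o b, t next b < n,
     w (t next b) < u (t next b) S, minimal n u w S
   & (t takes b != 0) = (g \in S) /\
     forall h : 'I_m, o h = b -> (t keep h != 0) = (h \in S)].

Lemma chooseP s (g : 'I_m) b : s pool 0 = g.+1 -> s ib 0 = b ->
  let t := run choose s in
  [/\ forall a : nat, a != b -> t next a = s next a /\ t takes a = s takes a,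
      forall h, s owner h != b -> t keep h = s keep h
    & t addee 0 = b.+1 /\
        (forall a, a < n -> u a (g |: part m (s owner) b) <= s value a) \/
      t addee 0 = s addee 0 /\
        exists S, chosen (s owner) (s value) g b S t].
Proof.
move=> poolE ibE; rewrite /choose 7!run_seq.
set t1 := run (load ib) s; set t2 := run (PAssign cand _ _) t1.
have t2E (a : nat) : a \notin [:: ih; cand] -> t2 a = s a.
  rewrite !inE negb_or => /andP[a_ih a_cand].
  by rewrite /t2 /= update_other // /t1 run_frame // !inE negb_or a_ih.
have t2S : bundle m t2 cand = g |: part m (s owner) b.
  have t1S : bundle m t1 cand = part m (s owner) b by rewrite -ibE -bundle_load.
  rewrite -t1S; apply/setP=> h; rewrite !inE /t2 /= update_same.
  rewrite [t1 pool]run_frame // poolE subn1 /= -[h == g]val_eqE /=.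
  by case: ((h : nat) == g).
have [sub wS minS] := shrinkP t2; set t3 := run shrink t2 in sub wS minS *.
set S := bundle m t3 cand in sub wS minS *; rewrite t2S in sub wS.
rewrite (t2E value) // in wS minS.
have t3E (a : nat) : a \notin [:: ih; saved; cand; fan; ia; reply] -> t3 a = s a.
  move=> Ha; rewrite -t2E /t3 ?run_frame //; move: Ha; rewrite !inE; lia.
have fan_t3 := fanP t3; rewrite -/S t3E // in fan_t3.
have fan_val := find_fanP t3; rewrite -/S t3E // in fan_val.
set t4 := run find_fan t3 in fan_t3 fan_val *.
set t5 := run (PIf _ _ _) t4; set t6 := run (PAssign next _ _) t5.
set t7 := run (PAssign takes _ _) t6; set t := run save_cand t7.
have t4E (a : nat) : a \notin [:: ih; saved; cand; fan; ia; reply] -> t4 a = s a.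
  move=> Ha; rewrite -t3E // /t4 run_frame //; move: Ha.
  by rewrite !inE; lia.
have t4S : t4 cand = t3 cand by rewrite /t4 run_frame.
have t5E (a : nat) : a != addee -> t5 a = t4 a.
  by move=> Ha; rewrite /t5 /=; case: ifP => // _; rewrite update_other.
have t6next a : t6 next a = if a == b then (t4 fan 0).-1 else s next a.
  by rewrite /t6 /= update_same !t5E // (t4E ib) // (t4E next) // ibE subn1.
have t6E (a : nat) : a != next -> t6 a = t5 a by move=> Ha; rewrite /t6 /= update_other.
have t7takes a : t7 takes a = if a == b then t3 cand g else s takes a.
  by rewrite /t7 /= update_same !t6E // !t5E // t4S (t4E ib) //
    (t4E pool) // (t4E takes) // ibE poolE subn1.
have t7E (a : nat) : a != takes -> t7 a = t6 a by move=> Ha; rewrite /t7 /= update_other.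
have tkeep h : t keep h =
    if (h < m) && (s owner h == b) then t3 cand h else s keep h.
  by rewrite /t save_candP !t7E // !t6E // !t5E // t4S (t4E owner) //
    (t4E ib) // (t4E keep) // ibE.
have tE (a : nat) : a \notin [:: ih; keep] -> t a = t7 a by move=> ?; apply: run_frame.
split=> [a ab|h hb|].
- by rewrite !tE // t7takes t7E // t6next (negPf ab).
- by rewrite tkeep (negPf hb) andbF.
have taddee : t addee 0 = if t4 fan 0 != 0 then s addee 0 else b.+1.
  rewrite tE // t7E // t6E // /t5 /=; case: ifP => _; first by rewrite t4E.
  by rewrite update_same eqxx (t4E ib) // ibE addn1.
rewrite taddee; case: ifP => [|/negbFE/eqP] fan0; last first.
  (* Shrinking preserves being wanted, so without a fan of [S] nobody wants the bundle before
     shrinking. *)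
  left; split=> // a lt_an; rewrite leqNgt; apply/negP=> lt_a.
  by move: fan0; apply/eqP/fan_t3/wS; exists a.
right; split=> //.
exists S; move: fan_val fan0; case fanE: (t4 fan 0) => [//|a] [lt_an lt_a] _.
have tnext : t next b = a by rewrite tE // t7E // t6next eqxx fanE.
split; rewrite ?tnext //; split=> [|h hb].
  by rewrite tE // t7takes eqxx inE.
by rewrite tkeep ltn_ord hb eqxx inE.
Qed.

Lemma choicesP s (g : 'I_m) : s pool 0 = g.+1 ->
  let t := run choices s in
  if t addee 0 is b.+1 then
    b < n /\ forall a, a < n -> u a (g |: part m (s owner) b) <= s value a
  else forall b, b < n -> exists S, chosen (s owner) (s value) g b S t.
Proof.
move=> poolE; pose P k (t : state) := if t addee 0 is b.+1 then
    b < n /\ forall a, a < n -> u a (g |: part m (s owner) b) <= s value a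
  else forall b, b < k -> exists S, chosen (s owner) (s value) g b S t.
suff: P n (run choices s) by [].
rewrite /choices run_seq; apply: (@for_ind _ n m v P ib Agents) => //.
move=> k t lt_kn tk fr IH.
have frs (a : nat) : a \notin ib :: addee :: writes choose -> t a = s a.
  rewrite -cat1s mem_cat negb_or inE => /andP[a_ib].
  rewrite -cat1s mem_cat negb_or inE => /andP[a_add a_ch].
  rewrite fr; first by rewrite /= update_other.
  by rewrite -cat1s mem_cat negb_or inE a_ib.
have t_pool : t pool 0 = g.+1 by rewrite frs.
have [nextE keepE addE] := chooseP t_pool tk.
rewrite !(frs owner, frs value) // in keepE addE.
rewrite /P update_other //; case: addE => [[-> unw]|[-> [S chS]]] //.
move: IH; rewrite /P; case: (t addee 0) => // IH b.
rewrite ltnS leq_eqVlt => /predU1P[->|lt_bk].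
  by exists S; rewrite /chosen !update_other.
(* Round [k] changes [next] and [takes] only at [k], and [keep] only at items owned by [k], so
   earlier records survive. *)
have [S' [subS lt_n wS minS [tkS kpS]]] := IH b lt_bk.
have neq_bk : b != k by rewrite ltn_eqF.
exists S'; rewrite /chosen !update_other //.
have [-> ->] := nextE b neq_bk; split=> //; split=> // h hb.
by rewrite keepE ?hb // kpS.
Qed.

(** The part of the cycle marked after [k] rounds; [visited f n] is convertible to
    [limit_cycle n f]. *)
Definition visited (f : nat -> nat) (k : nat) :=
  [seq iter (n + j.+1) f 0 | j <- iota 0 k].

Lemma visitedS f k b :
  (b \in visited f k.+1) = (b \in visited f k) || (b == iter (n + k.+1) f 0).
Proof.
have iotaE : iota 0 k.+1 = iota 0 k ++ [:: k] by rewrite -addn1 iotaD.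
by rewrite /visited iotaE map_cat mem_cat /= inE.
Qed.

Lemma find_cycleP s : let t := run find_cycle s in
  let C := limit_cycle n (s next) in
  (forall b, b <= n -> (t on b != 0) = (b \in C)) /\
  if t last 0 is d.+1 then d \in C /\ s takes d != 0
  else forall b, b \in C -> s takes b = 0.
Proof.
rewrite /find_cycle 4!run_seq; set t1 := run (set_var cur _) s.
set t2 := run (PFor ik Agents _) t1; set t3 := run (PFor ik Total _) t2.
set t4 := run (set_var last _) t3; set t := run (PFor ik Agents _) t4.
cbv zeta; set C := limit_cycle n (s next).
have t2cur : t2 cur 0 = iter n (s next) 0.
  pose P k (r : state) := r cur 0 = iter k (s next) 0.
  apply: (@for_ind _ n m v P ik Agents) => // k r lt_kn rk fr IH.
  by rewrite /P update_other //= update_same /= IH fr.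
have t3on b : b <= n -> t3 on b = 0.
  pose P k (r : state) := forall b, b < k -> r on b = 0.
  suff: P (n + m).+1 t3 by move=> + le_bn; apply; rewrite ltnS (leq_trans le_bn) ?leq_addr.
  apply: (@for_ind _ n m v P ik Total) => // k r lt_kn rk fr IH {}b.
  rewrite ltnS leq_eqVlt update_other //= update_same rk.
  by case: eqP => //= _; apply: IH.
pose P k (r : state) := [/\ r cur 0 = iter (n + k) (s next) 0,
  forall b, b <= n -> (r on b != 0) = (b \in visited (s next) k) &
  if r last 0 is d.+1 then d \in visited (s next) k /\ s takes d != 0
  else forall b, b \in visited (s next) k -> s takes b = 0].
suff [] : P n t by [].
apply: (@for_ind _ n m v P ik Agents) => //.
  split.
  - by rewrite update_other // /t4 /= update_other // /t3 run_frame // t2cur addn0.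
  - by move=> b le_bn; rewrite update_other // /t4 /= update_other // t3on.
  - by rewrite update_other // /t4 /= update_same.
move=> k r lt_kn rk fr [curE onE lastE].
have rn : r next = s next.
  by rewrite fr // /t4 /= update_other // /t3 run_frame // /t2 run_frame.
have rt : r takes = s takes.
  by rewrite fr // /t4 /= update_other // /t3 run_frame // /t2 run_frame.
set c := iter (n + k.+1) (s next) 0.
set r1 := run (set_var cur _ ;; _) r.
have [r1c r1o r1l] : [/\ r1 cur 0 = c, forall b, r1 on b = if b == c then 1 else r on b
    & r1 last 0 = if s takes c != 0 then c.+1 else r last 0].
  have cE : r next (r cur 0) = c by rewrite rn curE /c addnS.
  by rewrite /r1 /= /update /= cE rt; case: ifP => _; split=> //=; rewrite addn1.
split; rewrite update_other //.
  move=> b le_bn; rewrite r1o visitedS -/c -onE //.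
  by case: (b == c); rewrite ?orbT ?orbF.
rewrite r1l; case: ifP => [tkc|/negbFE/eqP tkc]; first by rewrite visitedS eqxx orbT.
move: lastE; case: (r last 0) => [|d] lastE.
  by move=> b; rewrite visitedS => /orP[/lastE//|/eqP->].
by rewrite visitedS; case: lastE => ->.
Qed.

Lemma rotateP s h : s 0 0 = n -> h < m -> run rotate s owner h =
  if (s last 0 != 0) && (h == (s pool 0).-1) then s next (s last 0).-1
  else if s on (s owner h) != 0 then
    if s keep h != 0 then s next (s owner h) else n
  else s owner h.
Proof.
move=> s0; rewrite /rotate run_seq; set t := run (PFor _ _ _) s => lt_hm.
have [frl frp frn] : [/\ t last = s last, t pool = s pool & t next = s next].
  by split; apply: run_frame.
set x := (X in _ = if _ then _ else X).
suff tE : t owner h = x.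
  rewrite /= frl frp frn; case: eqP => _ //=.
  by rewrite update_same !subn1 -tE.
rewrite /x {x}; pose P k (r : state) := forall h, r owner h =
  if h < k then if s on (s owner h) != 0 then
    if s keep h != 0 then s next (s owner h) else n
  else s owner h else s owner h.
suff: P m t by move=> ->; rewrite lt_hm.
apply: (@for_ind _ n m v P ih Items) => //= k r lt_km rk fr IH {h lt_hm}h.
have rk_o : r owner k = s owner k by rewrite IH ltnn.
rewrite rk (fr on) // (fr keep) // rk_o ltnS leq_eqVlt.
have [->|neq_hk] /= := eqVneq h k.
  case: ifP => _; last by rewrite update_other.
  by case: ifP => _; rewrite update_other // update_same eqxx fr.
rewrite -IH update_other //.
by case: ifP => _ //; case: ifP => _; rewrite update_same (negPf neq_hk).
Qed.

Lemma find_poolP s : s 0 0 = n ->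
  if run find_pool s pool 0 is g.+1 then g < m /\ s owner g = n
  else forall h, h < m -> s owner h != n.
Proof.
move=> s0; pose P k (t : state) :=
  if t pool 0 is g.+1 then g < m /\ s owner g = n
  else forall h, h < k -> s owner h != n.
suff: P m (run find_pool s) by [].
rewrite /find_pool run_seq; apply: (@for_ind _ n m v P ih Items) => //.
move=> k t lt_km tk fr IH; rewrite /P update_other //=.
rewrite tk !(fr owner, fr 0) //= !update_other // s0 neqe_eq.
have [ok|nok] /= := eqVneq (s owner k) n; first by rewrite update_same /= addn1.
move: IH; rewrite /P; case: (t pool 0) => // IH h.
by rewrite ltnS leq_eqVlt => /predU1P[->|/IH].
Qed.

Lemma valuesP s a : a < n -> run values s value a = u a (part m (s owner) a).
Proof.
pose P k (t : state) := forall a, a < k -> t value a = u a (part m (s owner) a).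
suff: P n (run values s) by apply.
apply: (@for_ind _ n m v P ib Agents) => // k t lt_kn tk fr IH {}a.
rewrite 2!run_seq; set t1 := run (load ib) t.
have t1b : t1 ib 0 = k by rewrite /t1 run_frame.
have t1S : bundle m t1 cand = part m (s owner) k.
  by rewrite -(fr owner) // -tk -bundle_load.
have t1v : t1 value = t value by rewrite /t1 run_frame.
rewrite update_other //= update_same [update _ reply _ _ ib]update_other //.
rewrite [update _ reply _ _ value]update_other // update_same eqxx t1b t1S t1v.
rewrite ltnS leq_eqVlt.
by have [->|_ /= /IH] := eqVneq a k.
Qed.

(** * Progress of a round and number of rounds *)

Hypothesis n_gt0 : 0 < n.

Lemma rotate_improves s t (o : nat -> nat) (g : 'I_m) :
  s 0 0 = n -> (forall h, h < m -> o h <= n) -> o g = n -> s owner = o ->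
  s pool 0 = g.+1 -> EFX_owner n u o ->
  (forall b, b < n -> exists S,
     chosen o (fun a => u a (part m o a)) g b S s) ->
  t = run rotate (run find_cycle s) ->
  [/\ EFX_owner n u (t owner), forall h, h < m -> t owner h <= n
    & potential n u o < potential n u (t owner)].
Proof.
move=> s0 o_le og so poolE efx chS tE; set f := s next.
have [S {}chS] : exists S : nat -> {set 'I_m}, forall b, b < n ->
    chosen o (fun a => u a (part m o a)) g b (S b) s.
  have /boolp.choice[S HS] : forall b, exists S, b < n ->
      chosen o (fun a => u a (part m o a)) g b S s.
    by move=> b; case: (ltnP b n) => [/chS[S HS]|_]; [exists S | exists set0].
  by exists S.
have f_lt b : b < n -> f b < n by case/chS.
have [onE lastE] := find_cycleP s; rewrite -/f in onE lastE.
set C := limit_cycle n f in onE lastE.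
set r := run find_cycle s in tE onE lastE; set L := r last 0 in lastE.
have C_lt b : b \in C -> b < n by apply: limit_cycle_lt.
have nC : n \notin C by apply/negP=> /C_lt; rewrite ltnn.
have fC b : b \in C -> f b \in C by apply: limit_cycle_next.
have f_inj := limit_cycle_inj f_lt n_gt0.
have LC : L != 0 -> L.-1 \in C /\ g \in S L.-1.
  case: L lastE => //= d [dC takes_d] _; split=> //.
  by have [_ _ _ _ [<- _]] := chS _ (C_lt _ dC).
have tg : t owner g = if L != 0 then f L.-1 else n.
  rewrite tE rotateP // ?[r 0]run_frame // [r pool]run_frame // poolE eqxx andbT.
  rewrite [r owner]run_frame // so og onE // (negPf nC).
  by rewrite [r next]run_frame.
have tNg (h : 'I_m) : h != g -> t owner h =
    if o h \in C then if h \in S (o h) then f (o h) else n else o h.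
  move=> hg; rewrite tE rotateP // ?[r 0]run_frame // [r pool]run_frame // poolE.
  rewrite val_eqE (negPf hg) andbF [r owner]run_frame // so onE ?o_le //.
  case: ifP => // /C_lt/chS[_ _ _ _ [_ keepE]].
  by rewrite [r keep]run_frame // keepE // [r next]run_frame.
have S_part b (h : 'I_m) : b \in C -> h != g -> h \in S b -> o h = b.
  move=> /C_lt/chS[subS _ _ _ _] hg /(subsetP subS).
  by rewrite !inE (negPf hg) => /eqP.
(* Injectivity of [f] on the cycle ensures that [f b] receives items from [S b] only, and [g] only
   when [b] is [L.-1]. *)
have partC b : b \in C -> part m (t owner) (f b) =
    if (L != 0) && (b == L.-1) then S b else S b :\ g.
  move=> bC; apply/setP=> h; rewrite [LHS]inE.
  have fb_n : (n == f b) = false by rewrite gtn_eqF // f_lt // C_lt.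
  have [->|hg] := eqVneq h g.
    rewrite tg; have [L0|/LC[LinC gS]] /= := eqVneq L 0; first by rewrite fb_n !inE eqxx.
    have [->|neq] := eqVneq b L.-1; first by rewrite eqxx gS.
    rewrite !inE eqxx; apply: contraNF neq => /eqP.
    by move/(f_inj _ _ LinC bC)=> ->.
  have -> : (h \in if (L != 0) && (b == L.-1) then S b else S b :\ g) = (h \in S b).
    by case: ifP; rewrite // !inE hg.
  rewrite tNg //; case: ifP => [ohC|/negbT ohC]; last first.
    apply/eqP/idP => [e|/(S_part _ _ bC hg) e]; last by rewrite e bC in ohC.
    by rewrite e fC in ohC.
  case: ifP => [hS|/negbT hS].
    apply/eqP/idP => [/(f_inj _ _ ohC bC) <- //|].
    by move/(S_part _ _ bC hg)->.
  rewrite fb_n; apply/esym/negbTE; apply: contraNN hS => hS.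
  by rewrite (S_part _ _ bC hg hS).
have partNC a : a < n -> a \notin C -> part m (t owner) a = part m o a.
  move=> lt_an aC; apply/setP=> h; rewrite !inE.
  have a_n : (n == a) = false by rewrite gtn_eqF.
  have [->|hg] := eqVneq h g.
    rewrite tg og; case: ifP => // /LC[dC _]; rewrite a_n.
    by apply: contraNF aC => /eqP<-; apply: fC.
  rewrite tNg //; case: ifP => // ohC.
  have -> : (o h == a) = false by apply: contraNF aC => /eqP<-.
  by case: ifP => // _; apply: contraNF aC => /eqP<-; apply: fC.
have t_le h : h < m -> t owner h <= n.
  move=> lt_hm; rewrite -[h]/(val (Ordinal lt_hm)).
  have [->|hg] := eqVneq (Ordinal lt_hm) g.
    by rewrite tg; case: ifP => // /LC[/C_lt/f_lt/ltnW].
  rewrite tNg //; case: ifP => [/C_lt/f_lt/ltnW ?|_]; last exact: o_le.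
  by case: ifP.
have [efx' pot] :
    EFX_owner n u (t owner) /\ potential n u o < potential n u (t owner);
  last by split.
apply: (@rotate_bundles n m u (answer_setU1 v_binary) o (t owner) g f (mem C) S);
  rewrite //.
- by move=> b /C_lt/f_lt.
- by move=> b /C_lt/chS[].
- by move=> b /C_lt/chS[].
- by move=> a; apply: limit_cycle_surj.
- by move=> b bC; rewrite partC //; case: ifP; [left | right].
(* Some bundle passes on in full: that of [L.-1], or, if no set on the cycle contains [g], any of
   them; iterate [n.+1] is one. *)
- have [L0|L_neq0] := eqVneq L 0; last first.
    by have [dC _] := LC L_neq0; exists L.-1; rewrite // partC // L_neq0 eqxx.
  have bC : f (iter n f 0) \in C by apply/limit_cycleP => //; exists n.+1.
  exists (f (iter n f 0)) => //; rewrite partC // L0 /=.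
  have := C_lt _ bC => /chS[_ _ _ _ [gS _]].
  move: lastE; rewrite L0 => /(_ _ bC) tk0; rewrite tk0 eqxx in gS.
  apply/setP=> h; rewrite !inE; have [->|//] := eqVneq h g.
  by rewrite -gS.
Qed.

(** Recording an item unallocated before the round excludes the second outcome once the allocation
    is complete, so completeness persists. *)
Lemma improveP s : s 0 0 = n -> (forall h, h < m -> s owner h <= n) ->
  EFX_owner n u (s owner) ->
  let t := run improve s in
  [/\ EFX_owner n u (t owner), forall h, h < m -> t owner h <= n
    & (forall h, h < m -> t owner h < n) \/
      (exists2 h, h < m & s owner h = n) /\
      potential n u (s owner) < potential n u (t owner)].
Proof.
move=> s0 o_le efx; rewrite /improve run_seq; set s1 := run find_pool s.
have [s1o s10] : s1 owner = s owner /\ s1 0 0 = n by rewrite /s1 !run_frame.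
have poolE := find_poolP s0; rewrite -/s1 in poolE.
rewrite run_if [eval _ _]/=; case: ifP => [|/negbFE/eqP pool0]; last first.
  rewrite pool0 /= s1o in poolE *; split=> //; left=> h lt_hm.
  by rewrite ltn_neqAle poolE // o_le.
case pE: (s1 pool 0) poolE => [//|g'] [lt_gm og] _; pose g := Ordinal lt_gm.
rewrite 2!run_seq; set s2 := run values s1; set s3 := run choices s2.
have s2o : s2 owner = s owner by rewrite /s2 run_frame.
have s3o : s3 owner = s owner by rewrite /s3 run_frame.
have s2p : s2 pool 0 = g.+1 by rewrite /s2 run_frame.
have s3p : s3 pool 0 = g.+1 by rewrite /s3 run_frame.
have s30 : s3 0 0 = n by rewrite /s3 run_frame // /s2 run_frame.
have valE a : a < n -> s2 value a = u a (part m (s owner) a).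
  by move=> lt_an; rewrite /s2 valuesP // s1o.
have addE := choicesP s2p; cbv zeta in addE; rewrite -/s3 s2o in addE.
set t := run (PIf _ _ _) s3.
have {}tE : t = if s3 addee 0 != 0 then
    update s3 owner (s3 pool 0 - 1) (s3 addee 0 - 1)
  else run rotate (run find_cycle s3) by [].
case: (s3 addee 0) addE tE => [|b] addE tE; last first.
  have [lt_bn unw] := addE.
  rewrite /= s3p !subn1 /= in tE.
  have toE h : t owner h = if h == g :> nat then b else s owner h.
    by rewrite tE update_same s3o.
  have [||//|efx' pot] := @add_item n m u (answer_setU1 v_binary)
      (s owner) (t owner) g b lt_bn og.
  - by move=> h; rewrite toE val_eqE.
  - by move=> a lt_an; rewrite -valE // unw.
  split=> //; last by right; split=> //; exists g.
  by move=> h lt_hm; rewrite toE; case: ifP => _; [apply: ltnW | apply: o_le].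
have [|efx' t_le pot] := rotate_improves (g := g) s30 o_le og s3o s3p efx _ tE.
  move=> b /addE[S [subS lt_nb wS minS tk]]; exists S; split=> //.
    by rewrite -valE.
  by move=> a h lt_an hS; rewrite -valE // minS.
by split=> //; right; split=> //; exists g.
Qed.

(* The potential stops increasing only when every item is allocated. *)
Definition progress (j : nat) (s : state) :=
  [/\ s 0 0 = n, EFX_owner n u (s owner), forall h, h < m -> s owner h <= n
    & (forall h, h < m -> s owner h < n) \/ j <= potential n u (s owner)].

Lemma progress_improve j s : progress j s -> progress j.+1 (run improve s).
Proof.
case=> s0 efx o_le prog_j; have [efx' t_le pot] := improveP s0 o_le efx.
split=> //; first by rewrite run_frame.
case: pot => [|[[h lt_hm oh] lt_pot]]; [by left | right].
case: prog_j => [/(_ h lt_hm)|le_j]; first by rewrite oh ltnn.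
exact: leq_ltn_trans le_j lt_pot.
Qed.

(** Used once for each of the three nested loops. The bound [2 < i] keeps the counter off the arrays
    that [progress] reads. *)
Lemma progress_for c i p j s : 2 < i -> i \notin writes p ->
  (forall j s, progress j s -> progress (j + c) (run p s)) ->
  progress j s -> progress (j + (n + m).+1 * c) (run (PFor i Total p) s).
Proof.
move=> lt_2i ip step js.
have upd k x t : progress k t -> progress k (update t i 0 x).
  by rewrite /progress !update_other //; lia.
pose P k (t : state) := progress (j + k * c) t.
apply: (@for_ind _ n m v P i Total) => // [|k t lt_k tk fr IH].
  by rewrite /P addn0; apply: upd.
by rewrite /P mulSn addnCA addnC; apply/upd/step.
Qed.

Lemma efx_progP s : s 0 0 = n ->
  EFX_allocation v (@output n m (run efx_prog s)).
Proof.
move=> s0; rewrite /efx_prog run_seq; set t := run (PFor ih _ _) s.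
have t_n h : h < m -> t owner h = n.
  pose P k (r : state) := forall h, h < k -> r owner h = n.
  suff: P m t by apply.
  apply: (@for_ind _ n m v P ih Items) => // k r lt_km rk fr IH {}h.
  rewrite update_other //= update_same rk fr // s0 ltnS leq_eqVlt.
  by case: eqP => //= _ /IH.
(* All items start in the pool, so every bundle is empty and EFX is vacuous. *)
have t0 : progress 0 t.
  split; [by rewrite /t run_frame| |by move=> h /t_n->|by right].
  move=> i j h _ lt_jn; rewrite inE t_n // => /eqP jn.
  by rewrite -jn ltnn in lt_jn.
set N := (n + m).+1; have := t0; set r := run _ t => pr0.
have [r0 efx _ prog] : progress (0 + N * (N * (N * 1))) r.
  apply: progress_for t0 => // j1 s1; apply: progress_for => // j2 s2.
  apply: progress_for => // j3 s3 /progress_improve; by rewrite addn1.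
apply: EFX_output => //; case: prog => // le_pot.
(* The potential is at most [n * m * m.+1 + m], which is less than [N ^ 3]; only a complete
   allocation remains possible. *)
have := leq_trans le_pot
  (potential_bound n (answer0 v_binary) (answer_setU1 v_binary) _).
rewrite /N; nia.
Qed.

End Correctness.

Theorem theorem3p1 (R : realType) :
  (forall (n m : nat) (v : profile R n m),
     (0 < n)%N -> nonneg_profile v -> binary_profile v ->
     exists A : allocation n m, EFX_allocation v A) /\
  polytime_computable
    (fun (n m : nat) (v : profile R n m) =>
       [/\ (0 < n)%N, nonneg_profile v & binary_profile v])
    (fun (n m : nat) (v : profile R n m) (A : allocation n m) =>
       EFX_allocation v A).
Proof.
split=> [n m v n_gt0 _ v_binary|].
  exists (@output n m (run v efx_prog (init n m))).
  exact: efx_progP.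
have [c [d costP]] := cost_poly efx_prog.
exists (compile efx_prog), c, d => n m v [n_gt0 _ v_binary].
have [//|//|//|t exec_t le_t] := @compile_correct R n m v efx_prog (init n m).
exists t, (run v efx_prog (init n m)); split=> //.
  exact: leq_trans le_t (costP _ _).
exact: efx_progP.
Qed.
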